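(* Let $k\ge 2$ be an integer. For every $(u,v)=(\tfrac ik,\tfrac jk)\in\Delta_k$ (with $i,j\in\{0,1,\dots,k\}$) let $$N=\min\{i,j\}-\max\{0,i+j-k\},$$ and for every $\ell\in\{\max\{0,i+j-k\},\dots,\min\{i,j\}\}$ let $$\hat\ell=\ell-\max\{0,i+j-k\}\quad\text{and}\quad n_{\hat\ell}=|L_{ij\ell}|.$$ Then for every $w\in[0,1]$, $$\mathbb{P}[Y_k(u,v)\le w]=\frac{(k!-1)!}{\prod_{\hat\ell=0}^{N}(n_{\hat\ell}-1)!}\int_{D} t_0^{n_0-1}t_1^{n_1-1}\cdots t_N^{n_N-1}\,dt_1\ldots dt_N,$$ where $t_0=1-t_1-t_2-\dots-t_N$ and the domain of integration is $$D=\{(t_1,\dots,t_N)\in\mathbb{R}^N : t_1,\dots,t_N\ge 0,\ t_1+\dots+t_N\le 1,\ 1t_1+2t_2+\dots+Nt_N\le k(w-W(u,v))\}.$$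
   Context: Fix an integer $k\ge 2$. Let $[k]=\{1,\dots,k\}$, $\delta_k=\{0,\tfrac1k,\dots,\tfrac{k-1}{k},1\}$ and $\Delta_k=\delta_k\times\delta_k$. Let $W(u,v)=\max\{0,u+v-1\}$. Let $\mathcal{S}_k$ be the set of all permutations of $[k]$. For $\pi\in\mathcal{S}_k$, let $C_\pi\colon\Delta_k\to[0,1]$ be the discrete copula with mass $\tfrac1k$ in each square $[\tfrac{i-1}{k},\tfrac ik]\times[\tfrac{\pi(i)-1}{k},\tfrac{\pi(i)}{k}]$, $i\in[k]$, and mass $0$ in all other squares of the mesh; that is, $C_\pi(\tfrac ik,\tfrac jk)=\tfrac1k\,|\{m\in[k] : m\le i,\ \pi(m)\le j\}|$ for $i,j\in\{0,1,\dots,k\}$. Let $L_{ij\ell}=\{\pi\in\mathcal{S}_k : C_\pi(\tfrac ik,\tfrac jk)=\tfrac{\ell}{k}\}$. Let $\sigma^{k!-1}=\{(\alpha_\pi)_{\pi\in\mathcal{S}_k}\in\mathbb{R}^{k!} : \alpha_\pi\ge 0 \text{ for all } \pi,\ \sum_{\pi\in\mathcal{S}_k}\alpha_\pi=1\}$ be the standard simplex. The random discrete copula $Y_k$ is the random field over $\Delta_k$ given by $Y_k(u,v)=\sum_{\pi\in\mathcal{S}_k}\alpha_\pi C_\pi(u,v)$, where $\boldsymbol{\alpha}=(\alpha_\pi)_{\pi\in\mathcal{S}_k}$ is chosen uniformly at random from $\sigma^{k!-1}$ with respect to the Lebesgue measure on the simplex (equivalently, $\boldsymbol{\alpha}$ has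 the Dirichlet distribution with all $k!$ parameters equal to $1$). When $N=0$ (which happens exactly when $(u,v)$ is on the boundary of $[0,1]^2$), the integral is read as an integral over the one-point space $\mathbb{R}^0$ with its counting measure, with $t_0=1$ and the last constraint reading $0\le k(w-W(u,v))$. *)

(* Defs.v *)
From HB Require Import structures.
From mathcomp Require Import all_boot all_order all_algebra all_fingroup.
From mathcomp Require Import all_classical all_reals all_analysis.

Set Implicit Arguments.
Unset Strict Implicit.
Unset Printing Implicit Defensive.

Import Order.TTheory GRing.Theory Num.Theory.
Import numFieldNormedType.Exports.

Local Open Scope classical_set_scope.
Local Open Scope ring_scope.

(** * Lebesgue measure on [R^n], with [R^n] encoded as [n.-tuple R]

    The library has the product sigma-algebra on tuples but no n-dimensional
    Lebesgue measure. *)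

Section lebesgue_tuple.
Context {R : realType}.

(* [measurableTypeR R] is [R] with the display that [lebesgue_measure] uses. *)
Definition cons_pair n (p : measurableTypeR R * n.-tuple R) : n.+1.-tuple R :=
  [tuple of p.1 :: p.2].

Definition uncons n (t : n.+1.-tuple R) : measurableTypeR R * n.-tuple R :=
  (tnth t ord0, [tuple of behead t]).

Lemma cons_pairK n : cancel (@cons_pair n) (@uncons n).
Proof. by move=> [x t]; rewrite /uncons /cons_pair; congr pair; apply: val_inj. Qed.

Lemma measurable_cons_pair n : measurable_fun setT (@cons_pair n).
Proof.
by apply: measurable_cons; [exact: measurable_fst|exact: measurable_snd].
Qed.

Lemma measurable_uncons n : measurable_fun setT (@uncons n).
Proof.
apply: measurable_fun_pair => /=; first exact: measurable_tnth.
exact: measurable_behead.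
Qed.

Section lebesgue_tupleS.
Context n (m : {sigma_finite_measure set (n.-tuple R) -> \bar R}).

Definition lebesgue_tupleS : set (n.+1.-tuple R) -> \bar R :=
  pushforward (@lebesgue_measure R \x m)%E (@cons_pair n).

Let lebesgue_tupleS0 : lebesgue_tupleS set0 = 0%E.
Proof. by rewrite /lebesgue_tupleS /pushforward preimage_set0 measure0. Qed.

Let lebesgue_tupleS_ge0 A : (0 <= lebesgue_tupleS A)%E.
Proof. by rewrite /lebesgue_tupleS /pushforward; exact: measure_ge0. Qed.

Let lebesgue_tupleS_sigma_additive : semi_sigma_additive lebesgue_tupleS.
Proof.
move=> F mF tF mUF; rewrite /lebesgue_tupleS /pushforward preimage_bigcup.
apply: measure_semi_sigma_additive.
- move=> i; rewrite -[X in measurable X]setTI; exact: measurable_cons_pair.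
- apply/trivIsetP => /= i j _ _ ij; rewrite -preimage_setI.
  by move/trivIsetP : tF => /(_ _ _ _ _ ij) ->//; rewrite preimage_set0.
- rewrite -preimage_bigcup -[X in measurable X]setTI.
  exact: measurable_cons_pair.
Qed.

HB.instance Definition _ := isMeasure.Build _ _ _ lebesgue_tupleS
  lebesgue_tupleS0 lebesgue_tupleS_ge0 lebesgue_tupleS_sigma_additive.

Let lebesgue_tupleS_sigma_finite : sigma_finite setT lebesgue_tupleS.
Proof.
have /sigma_finiteP[F [TF ndF Foo]] := sigma_finiteT (@lebesgue_measure R).
have /sigma_finiteP[G [TG ndG Goo]] := sigma_finiteT m.
exists (fun i => @uncons n @^-1` (F i `*` G i)).
  rewrite -preimage_bigcup -[LHS](preimage_setT (@uncons n)); congr preimage.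
  apply/esym/seteqP; split=> // -[x t] _.
  have [i _ Fx] : (\bigcup_i F i) x by rewrite -TF.
  have [j _ Gt] : (\bigcup_i G i) t by rewrite -TG.
  exists (maxn i j) => //; split => /=.
  - by move: x Fx; exact/subsetPset/ndF/leq_maxl.
  - by move: t Gt; exact/subsetPset/ndG/leq_maxr.
move=> i; have [mF Fi] := Foo i; have [mG Gi] := Goo i; split.
  by rewrite -[X in measurable X]setTI; apply: measurable_uncons => //;
    exact: measurableX.
rewrite /lebesgue_tupleS /pushforward -comp_preimage.
rewrite (_ : @uncons n \o _ = id); last by apply/funext => p; exact: cons_pairK.
by rewrite preimage_id product_measure1E// lte_mul_pinfty// ge0_fin_numE.
Qed.

HB.instance Definition _ := Measure_isSigmaFinite.Build _ _ _
  lebesgue_tupleS lebesgue_tupleS_sigma_finite.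

End lebesgue_tupleS.

(* On the one-point space [R^0] this is the counting measure. *)
Fixpoint lebesgue_tuple n : {sigma_finite_measure set (n.-tuple R) -> \bar R} :=
  match n with
  | 0 => dirac [tuple]
  | n'.+1 => lebesgue_tupleS (lebesgue_tuple n')
  end.

End lebesgue_tuple.

(** * Uniform distribution on the standard simplex of [R^m] *)

Section uniform_simplex.
Context {R : realType}.
Implicit Type m : nat.

Definition std_simplex m : set (m.-tuple R) :=
  [set a | (forall i, 0 <= tnth a i) /\ \sum_(i < m) tnth a i = 1].

(* For [0 < m], the affine parametrization
   (t_1, .., t_(m-1)) |-> (1 - t_1 - .. - t_(m-1), t_1, .., t_(m-1))
   of the hyperplane of vectors with coordinate sum 1. *)
Definition simplex_chart m (t : m.-1.-tuple R) : m.-tuple R :=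
  [tuple nth 0 (1 - \sum_(i < m.-1) tnth t i :: t) i | i < m].

(* The (m-1)-dimensional Lebesgue measure on that hyperplane, up to a constant
   factor that depends on the choice of chart and cancels in
   [uniform_simplex]. *)
Definition hyperplane_lebesgue m : set (m.-tuple R) -> \bar R :=
  pushforward (lebesgue_tuple m.-1) (@simplex_chart m).

Definition uniform_simplex m (A : set (m.-tuple R)) : \bar R :=
  (hyperplane_lebesgue (A `&` @std_simplex m)
     / hyperplane_lebesgue (@std_simplex m))%E.

(* The random vector [(alpha i)_(i : I)], listed in the order of [enum I],
   is uniformly distributed on the standard simplex of [R^I]. *)
Definition uniform_on_simplex d (Om : measurableType d) (P : probability Om R)
    (I : finType) (alpha : I -> {RV P >-> R}) : Prop :=
  forall A : set (#|I|.-tuple R), measurable A ->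
    P [set om | A [tuple alpha (enum_val i) om | i < #|I|]] =
    uniform_simplex A.

End uniform_simplex.

(** * Discrete copulas

    A point (i/k, j/k) of the mesh is represented by its indices (i, j), and
    [k] = {1, .., k} by ['I_k] = {0, .., k-1}: an element m of ['I_k] stands
    for m + 1, so that "m <= i" in [k] reads [(m < i)%N]. *)

Section copula.
Context {R : realType}.

Definition frechet_lower (u v : R) : R := Num.max 0 (u + v - 1).

Definition perm_copula k (pi : {perm 'I_k}) (i j : 'I_k.+1) : R :=
  k%:R^-1 * #|[set m : 'I_k | (m < i)%N && (pi m < j)%N]%SET|%:R.

Definition random_copula k d (Om : measurableType d) (P : probability Om R)
    (alpha : {perm 'I_k} -> {RV P >-> R}) (i j : 'I_k.+1) (om : Om) : R :=
  \sum_(pi : {perm 'I_k}) alpha pi om * perm_copula pi i j.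

End copula.

Definition perms_with_value (R : realType) k (i j : 'I_k.+1) (l : nat) :
    {set {perm 'I_k}} :=
  [set pi | perm_copula pi i j == l%:R / k%:R :> R]%SET.

(* Main.v *)
Require Import Defs.
From HB Require Import structures.
From mathcomp Require Import all_boot all_order all_algebra all_fingroup.
From mathcomp Require Import all_classical all_reals all_analysis.
From mathcomp Require Import measurable_realfun.
From mathcomp Require Import ring zify.

Set Implicit Arguments.
Unset Strict Implicit.
Unset Printing Implicit Defensive.

Import Order.TTheory GRing.Theory Num.Theory.
Import numFieldNormedType.Exports.

Local Open Scope classical_set_scope.
Local Open Scope ring_scope.

(** Removing one barycentric coordinate of the simplex, the event becomes
    [c0 (1 - sum t) + sum c_l t_l <= K], so its volume is an iterated integral
    of a function of the two numbers [S = sum t] and [T = sum c_l t_l] only.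
    Integrating out one coordinate with label [c] is the operator
    [(A_c H)(S, T) = int_(x >= 0) H(S + x, T + c x) dx] on nonnegative functions
    of the plane.  These operators commute (Tonelli), and their powers are
    [A_c^(n+1) H = int_(x >= 0) x^n/n! H(S + x, T + c x) dx], which is where the
    factors [t_l^(n_l - 1) / (n_l - 1)!] come from once equal labels are grouped.
    With [E_c] the indicator of [S <= 1, T + c (1 - S) <= K], the reflection
    [x -> 1 - S - x] gives [A_c E_d = A_d E_c], so the label of the removed
    coordinate can be exchanged with any other one, in particular with [0]. *)

(** * Translation and reflection invariance of integrals on the line *)

Section lebesgue_affine.
Context {R : realType}.
Notation mu := (@lebesgue_measure R).

(** A translate of a half-open interval keeps its length, and Lebesgue measure is determined by its
    values on such intervals. *)
Lemma lebesgue_measureD (a : R) (A : set R) : measurable A ->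
  pushforward mu (fun x : measurableTypeR R => x + a : measurableTypeR R) A = mu A.
Proof.
move=> mA.
have mD : measurable_fun setT (fun x : measurableTypeR R => x + a : measurableTypeR R).
  exact: measurable_funD.
pose shift := fun x : measurableTypeR R => x + a : measurableTypeR R.
pose mD' := isMeasurableFun.Build _ _ _ _ shift mD.
pose D : {mfun measurableTypeR R >-> measurableTypeR R} := HB.pack shift mD'.
apply/esym; rewrite -[RHS]/(pushforward mu D A).
apply: lebesgue_measure_unique => // _ [[b c]] _ <-.
transitivity (mu `](b - a), (c - a)]%classic); last first.
  by congr (mu _); apply/seteqP; split=> x /=; rewrite !in_itv/= ltrBlDr lerBrDr.
by rewrite !lebesgue_measure_itv/= !lte_fin ltrD2r -!EFinD opprB subrKA.
Qed.

Lemma ge0_integral_shift (f : measurableTypeR R -> \bar R) (a : R) :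
  measurable_fun setT f -> (forall x, 0 <= f x)%E ->
  (\int[mu]_x f (x + a)%R = \int[mu]_x f x)%E.
Proof.
move=> mf f0.
have mD : measurable_fun setT (fun x : measurableTypeR R => x + a : measurableTypeR R).
  exact: measurable_funD.
rewrite -[LHS](@ge0_integral_pushforward _ _ _ _ _ _ mD mu setT f)//.
by apply: eq_measure_integral => A mA _; exact: lebesgue_measureD.
Qed.

Lemma ge0_integral_opp (f : measurableTypeR R -> \bar R) :
  measurable_fun setT f -> (forall x, 0 <= f x)%E ->
  (\int[mu]_x f (- x)%R = \int[mu]_x f x)%E.
Proof.
move=> mf f0.
have mN : measurable_fun setT (fun x : measurableTypeR R => - x : measurableTypeR R).
  exact: oppr_measurable.
rewrite -[LHS](@ge0_integral_pushforward _ _ _ _ _ _ mN mu setT f)//.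
by apply: eq_measure_integral => A mA _; exact: lebesgue_measureN.
Qed.

Lemma ge0_integral_reflect (f : measurableTypeR R -> \bar R) (a : R) :
  measurable_fun setT f -> (forall x, 0 <= f x)%E ->
  (\int[mu]_x f (a - x)%R = \int[mu]_x f x)%E.
Proof.
move=> mf f0; rewrite -(ge0_integral_shift a mf)// -(ge0_integral_opp (f := fun x => f (x + a)))//.
- by apply: eq_integral => x _; rewrite addrC.
- apply: measurableT_comp => //; exact: measurable_funD.
Qed.

End lebesgue_affine.

(** * Truncated powers and their convolution *)

Section gamma_weight.
Context {R : realType}.
Notation mu := (@lebesgue_measure R).
Notation M := (measurableTypeR R).

(** The truncated power [x_+^n / n!], an (n+1)-fold convolution power of the Heaviside function. The
    cut-off sits in the weight so that integrals run over the whole line. *)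
Definition gamma_weight (n : nat) (x : R) : R := (0 <= x)%R%:R * (x ^+ n / n`!%:R).

Lemma gamma_weight_ge0 n x : 0 <= gamma_weight n x.
Proof.
rewrite /gamma_weight; have [x0|]/= := leP 0 x; rewrite ?mul0r//.
by rewrite mul1r divr_ge0// exprn_ge0.
Qed.

Lemma measurable_gamma_weight n : measurable_fun setT (gamma_weight n : M -> R).
Proof.
apply: measurable_funM; last first.
  by apply: measurable_funM => //; apply: measurable_funX.
apply: (measurableT_comp (f := fun b : bool => b%:R : R)) => //.
by apply: measurable_fun_ler.
Qed.

Lemma gamma_weight0 x : gamma_weight 0 x = (0 <= x)%R%:R.
Proof. by rewrite /gamma_weight expr0 divr1 mulr1. Qed.

Lemma ge0_gamma_weightE n x : 0 <= x -> gamma_weight n x = x ^+ n / n`!%:R.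
Proof. by rewrite /gamma_weight => ->; rewrite mul1r. Qed.

Lemma lt0_gamma_weightE n x : x < 0 -> gamma_weight n x = 0.
Proof. by rewrite /gamma_weight leNgt => ->; rewrite mul0r. Qed.

(** For [z > 0] the integrand lives on [[0, z]] and the fundamental theorem of calculus applies. For
    [z < 0] the two supports are disjoint, and for [z = 0] they meet in one null point. *)
Lemma integral_gamma_weight n (z : R) :
  (\int[mu]_x (gamma_weight n x * gamma_weight 0 (z - x))%:E =
   (gamma_weight n.+1 z)%:E)%E.
Proof.
have [z0|z0|<-] := ltgtP 0 z.
- transitivity (\int[mu]_(x in `[0%R, z]) (x ^+ n / n`!%:R)%:E)%E.
    rewrite [RHS]integral_mkcond; apply: eq_integral => x _.
    rewrite patchE gamma_weight0 subr_ge0 /gamma_weight.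
    case: ifPn => [|].
      by rewrite inE/= in_itv/= => /andP[-> ->]; rewrite mul1r mulr1.
    rewrite notin_setE/= in_itv/= => /negP; rewrite negb_and.
    by move=> /orP[] /negPf ->; rewrite ?mul0r ?mulr0.
  rewrite (@continuous_FTC2 _ _ (fun x => x ^+ n.+1 / n.+1`!%:R))//.
  + by rewrite expr0n/= mul0r sube0 /gamma_weight (ltW z0) mul1r.
  + apply: continuous_subspaceT => x.
    by apply: cvgM; [exact: exprn_continuous|exact: cvg_cst].
  + split.
    * by move=> x _; apply: derivableM => //; apply: exprn_derivable.
    * apply: cvg_at_right_filter; apply: cvgM; [exact: exprn_continuous|exact: cvg_cst].
    * apply: cvg_at_left_filter; apply: cvgM; [exact: exprn_continuous|exact: cvg_cst].
  + move=> x _; rewrite derive1Mr; last exact: exprn_derivable.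
    rewrite exp_derive1 factS natrM invfM /GRing.scale/=.
    rewrite /GRing.scale/= mulrA [n.+1%:R * _]mulrC mulfK//.
- rewrite integral0_eq; last first.
    move=> x _; rewrite gamma_weight0 subr_ge0 /gamma_weight.
    have [x0|]/= := leP 0 x; last by rewrite !mul0r.
    by rewrite leNgt (lt_le_trans z0 x0)/= mulr0.
  by rewrite /gamma_weight leNgt z0/= mul0r.
- rewrite (_ : gamma_weight _ _ = 0); last by rewrite /gamma_weight expr0n/= mul0r mulr0.
  transitivity (\int[mu]_(x in [set 0%R]) (gamma_weight n x * gamma_weight 0 (0 - x))%:E)%E.
    rewrite [RHS]integral_mkcond; apply: eq_integral => x _.
    rewrite patchE; case: ifPn => //; rewrite notin_setE/= => x0.
    rewrite gamma_weight0 sub0r oppr_ge0 /gamma_weight.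
    by have [|/ltW|]/= := ltgtP 0 x; rewrite ?mul0r ?mulr0// => ?; exfalso; apply/x0/esym.
  by rewrite integral_set1.
Qed.

End gamma_weight.

Lemma foldr_nseq (T1 T2 : Type) (g : T1 -> T2 -> T2) (z : T2) (x : T1) n :
  foldr g z (nseq n x) = iter n (g x) z.
Proof. by elim: n => //= n ->. Qed.

(** * Integration along rays in the plane of the pairs (S, T) *)

Section ray_integral.
Context {R : realType}.
Notation mu := (@lebesgue_measure R).
Notation M := (measurableTypeR R).
Implicit Types (H : M * M -> \bar R) (p : M * M) (c d : R) (n m : nat).

(* [ray_integral 0 c] is the operator [A_c] of the header. *)
Definition ray_integral n c H p : \bar R :=
  (\int[mu]_x ((gamma_weight n x)%:E * H ((p.1 + x)%R, (p.2 + c * x)%R)))%E.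

Definition ge0_measurable H :=
  measurable_fun setT H /\ (forall p, 0 <= H p)%E.

Lemma measurable_ray c :
  measurable_fun setT (fun z : M * M * M => (z.1.1 + z.2, z.1.2 + c * z.2) : M * M).
Proof.
have m1 : measurable_fun setT (fun z : M * M * M => z.1.1).
  by apply: (measurableT_comp (f := fst)) => //; exact: measurable_fst.
have m2 : measurable_fun setT (fun z : M * M * M => z.1.2).
  by apply: (measurableT_comp (f := snd)) => //; exact: measurable_fst.
apply: measurable_fun_pair; apply: measurable_funD => //.
by apply: measurable_funM => //; exact: measurable_cst.
Qed.

Lemma measurable_rayr c p :
  measurable_fun setT (fun x : M => (p.1 + x, p.2 + c * x) : M * M).
Proof.
by apply: measurable_fun_pair; apply: measurable_funD.
Qed.

Lemma measurable_ray_integrand n c H p : ge0_measurable H ->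
  measurable_fun setT (fun x : M => (gamma_weight n x)%:E * H ((p.1 + x)%R, (p.2 + c * x)%R))%E.
Proof.
move=> [mH _]; apply: emeasurable_funM.
  by apply/measurable_EFinP; exact: measurable_gamma_weight.
apply: (measurableT_comp mH); exact: measurable_rayr.
Qed.

(** Measurability in the base point is the measurability of partial integrals in Tonelli's theorem.
    It allows the operators to be iterated. *)
Lemma ge0_ray_integral n c H : ge0_measurable H -> ge0_measurable (ray_integral n c H).
Proof.
move=> [mH H0]; split; last first.
  move=> p; apply: integral_ge0 => x _.
  by rewrite mule_ge0// lee_fin gamma_weight_ge0.
apply: (@measurable_fun_fubini_tonelli_F _ _ _ _ _ mu (fun z : M * M * M =>
  (gamma_weight n z.2)%:E * H ((z.1.1 + z.2)%R, (z.1.2 + c * z.2)%R)))%E.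
- apply: emeasurable_funM.
    apply/measurable_EFinP; apply: (measurableT_comp (measurable_gamma_weight n)).
    exact: measurable_snd.
  apply: (measurableT_comp mH); exact: measurable_ray.
- by move=> z; rewrite mule_ge0// lee_fin gamma_weight_ge0.
Qed.

Lemma ray_integral_comp n c m d H p : ge0_measurable H ->
  (ray_integral n c (ray_integral m d H) p =
  \int[mu]_x \int[mu]_y ((gamma_weight n x * gamma_weight m y)%:E *
     H (p.1 + x + y, p.2 + c * x + d * y)%R))%E.
Proof.
move=> mH; apply: eq_integral => x _; rewrite /ray_integral -ge0_integralZl//.
- by apply: eq_integral => y _; rewrite EFinM muleA.
- exact: (measurable_ray_integrand m d (_, _)).
- by move=> y _; rewrite mule_ge0 ?lee_fin ?gamma_weight_ge0//; apply: mH.2.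
- by rewrite lee_fin gamma_weight_ge0.
Qed.

Lemma measurable_ray_integrand2 n c m d H p : ge0_measurable H ->
  measurable_fun setT (fun z : M * M => (gamma_weight n z.1 * gamma_weight m z.2)%:E *
     H (p.1 + z.1 + z.2, p.2 + c * z.1 + d * z.2)%R)%E.
Proof.
move=> [mH _]; apply: emeasurable_funM.
  apply/measurable_EFinP; apply: measurable_funM.
    by apply: (measurableT_comp (measurable_gamma_weight n)); exact: measurable_fst.
  by apply: (measurableT_comp (measurable_gamma_weight m)); exact: measurable_snd.
apply: (measurableT_comp mH).
apply: measurable_fun_pair.
  apply: measurable_funD; last exact: measurable_snd.
  by apply: measurable_funD => //; exact: measurable_fst.
apply: measurable_funD; last by apply: measurable_funM => //; exact: measurable_snd.
by apply: measurable_funD => //; apply: measurable_funM => //; exact: measurable_fst.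
Qed.

Lemma ray_integralC n c m d H : ge0_measurable H ->
  ray_integral n c (ray_integral m d H) = ray_integral m d (ray_integral n c H).
Proof.
move=> mH; apply/funext => p; rewrite (ray_integral_comp n c m d p mH).
rewrite (ray_integral_comp m d n c p mH).
rewrite (@fubini_tonelli _ _ _ _ _ mu mu (fun z : M * M =>
    (gamma_weight n z.1 * gamma_weight m z.2)%:E *
     H (p.1 + z.1 + z.2, p.2 + c * z.1 + d * z.2)%R)%E); last 2 first.
- exact: measurable_ray_integrand2.
- by move=> z; apply: mule_ge0; [rewrite lee_fin mulr_ge0 ?gamma_weight_ge0|exact: mH.2].
apply: eq_integral => x _; apply: eq_integral => y _ /=.
by rewrite mulrC addrAC [p.2 + _ + _]addrAC.
Qed.

Lemma ray_integralS n c H : ge0_measurable H ->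
  ray_integral n c (ray_integral 0 c H) = ray_integral n.+1 c H.
Proof.
move=> mH; apply/funext => p; rewrite (ray_integral_comp n c 0 c p mH).
(* This is the double integrand after the substitution [z = x + y]. Here [H] sees only [z], so
   integrating out [x] first leaves the convolution of [integral_gamma_weight]. *)
pose F (x z : M) := ((gamma_weight n x * gamma_weight 0 (z - x))%:E *
   H ((p.1 + z)%R, (p.2 + c * z)%R))%E.
have mg : measurable_fun setT (fun z : M * M =>
    gamma_weight n z.1 * gamma_weight 0 (z.2 - z.1) : R).
  apply: measurable_funM.
    by apply: (measurableT_comp (measurable_gamma_weight n)); exact: measurable_fst.
  apply: (measurableT_comp (measurable_gamma_weight 0)); apply: measurable_funB.
    exact: measurable_snd.
  exact: measurable_fst.
have mF : measurable_fun setT (fun z : M * M => F z.1 z.2).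
  apply: emeasurable_funM; first exact/measurable_EFinP.
  apply: (measurableT_comp mH.1); apply: (measurableT_comp (measurable_rayr c p)).
  exact: measurable_snd.
have F0 x z : (0 <= F x z)%E.
  by apply: mule_ge0; [rewrite lee_fin mulr_ge0 ?gamma_weight_ge0|exact: mH.2].
transitivity (\int[mu]_x \int[mu]_z F x z)%E.
  apply: eq_integral => x _; rewrite -(ge0_integral_shift x (f := F x))//.
    by apply: eq_integral => y _; rewrite /F addrK mulrDr !(addrC y) !(addrC (c * y)) !addrA.
  exact: (measurableT_comp mF (pair1_measurable x)).
rewrite (@fubini_tonelli _ _ _ _ _ mu mu (fun z => F z.1 z.2))//.
apply: eq_integral => z _; rewrite /F/= ge0_integralZr//.
- by rewrite integral_gamma_weight.
- apply/measurable_EFinP; exact: (measurableT_comp mg (pair2_measurable z)).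
- by move=> x _; rewrite lee_fin mulr_ge0 ?gamma_weight_ge0.
- exact: mH.2.
Qed.

Lemma ge0_iter_ray_integral n m c H : ge0_measurable H ->
  ge0_measurable (iter m (ray_integral n c) H).
Proof. by move=> mH; elim: m => //= m; exact: ge0_ray_integral. Qed.

Lemma iter_ray_integral n c H : ge0_measurable H ->
  iter n.+1 (ray_integral 0 c) H = ray_integral n c H.
Proof.
elim: n H => // n IH H mH; rewrite iterSr IH ?ray_integralS//.
exact: ge0_ray_integral.
Qed.

Lemma ge0_foldr_ray_integral n s H : ge0_measurable H ->
  ge0_measurable (foldr (ray_integral n) H s).
Proof. by move=> mH; elim: s => //= c s; exact: ge0_ray_integral. Qed.

Lemma perm_foldr_ray_integral n s1 s2 H : ge0_measurable H -> perm_eq s1 s2 ->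
  foldr (ray_integral n) H s1 = foldr (ray_integral n) H s2.
Proof.
move=> mH; elim: s1 s2 => [|c s1 IH] s2; first by rewrite perm_sym => /perm_nilP ->.
move=> s12; have cs2 : c \in s2 by rewrite -(perm_mem s12) mem_head.
have : perm_eq s1 (rem c s2).
  by rewrite -(perm_cons c); apply: (perm_trans s12); exact: perm_to_rem.
(* It remains to pull [c] to the front of [s2], with one commutation for each entry before its first
   occurrence. *)
move=> /IH /= ->; move: cs2; elim: s2 {s12} => //= e s2 IH2.
have [->//|ec] := eqVneq e c; rewrite inE eq_sym (negPf ec)/= => /IH2 <-.
by rewrite ray_integralC//; exact: ge0_foldr_ray_integral.
Qed.

End ray_integral.

(** * The indicator of a slab of the simplex, and the exchange of labels *)

Section simplex_slab.
Context {R : realType}.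
Notation mu := (@lebesgue_measure R).
Notation M := (measurableTypeR R).
Implicit Types (H : M * M -> \bar R) (p : M * M) (K c d : R).

(* [gamma_weight 0] is the indicator of [0 <= x], so this is [E_c]. *)
Definition simplex_slab K c p : \bar R :=
  (gamma_weight 0 (1 - p.1) * (p.2 + c * (1 - p.1) <= K)%R%:R)%:E.

Lemma ge0_simplex_slab K c : ge0_measurable (simplex_slab K c).
Proof.
split; last by move=> p; rewrite lee_fin mulr_ge0 ?gamma_weight_ge0.
apply/measurable_EFinP.
have m1 : measurable_fun setT (fun p : M * M => 1 - p.1 : R).
  by apply: measurable_funB => //; exact: measurable_fst.
apply: measurable_funM; first exact: (measurableT_comp (measurable_gamma_weight 0)).
apply: (measurableT_comp (f := fun b : bool => b%:R : R)) => //.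
apply: measurable_fun_ler => //; apply: measurable_funD; first exact: measurable_snd.
exact: measurable_funM.
Qed.

(** The length [1 - S] is split into [x] with label [c] and [1 - S - x] with label [d], both
    nonnegative. The reflection swaps the two parts. *)
Lemma ray_integral_simplex_slab K c d :
  ray_integral 0 c (simplex_slab K d) = ray_integral 0 d (simplex_slab K c).
Proof.
apply/funext => p; rewrite [RHS]/ray_integral.
rewrite -(ge0_integral_reflect (1 - p.1)); last 2 first.
- by apply: measurable_ray_integrand; exact: ge0_simplex_slab.
- move=> x; apply: mule_ge0; first by rewrite lee_fin gamma_weight_ge0.
  exact: (ge0_simplex_slab K c).2.
apply: eq_integral => x _; rewrite /simplex_slab/= -!EFinM; congr EFin.
rewrite mulrCA; congr (_ * (_ * _)).
- by rewrite opprD addrA.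
- by congr gamma_weight; ring.
- by congr (nat_of_bool (_ <= _))%:R; ring.
Qed.

(** If [c] and [d] differ, then [d] occurs in [s1] and [c] in [s2]. Commutation moves each of them
    innermost, next to the slab, where the reflection exchanges them. The rest of the two lists
    agree up to order. *)
Lemma perm_simplex_slab K c d s1 s2 : perm_eq (c :: s1) (d :: s2) ->
  foldr (ray_integral 0) (simplex_slab K c) s1 =
  foldr (ray_integral 0) (simplex_slab K d) s2.
Proof.
have mK e := ge0_simplex_slab K e.
have [->|cd] := eqVneq c d.
  by rewrite perm_cons; exact: perm_foldr_ray_integral.
move=> s12.
have ds1 : d \in s1.
  by have := perm_mem s12 d; rewrite !inE eqxx eq_sym (negPf cd).
have E1 : perm_eq s1 (rcons (rem d s1) d).
  by rewrite (perm_trans (perm_to_rem ds1))// perm_sym perm_rcons.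
have E2 : perm_eq s2 (rcons (rem d s1) c).
  (* Counts are compared after adding the entry [d] to both sides, so that [s12] applies. *)
  apply/seq.permP => a; apply/eqP; rewrite -(eqn_add2l (a d)) -[X in X == _]/(count a (d :: s2)).
  rewrite -(seq.permP s12) /= (seq.permP E1) -!cats1 !count_cat /= !addn0.
  by apply/eqP; rewrite addnCA [RHS]addnCA [X in (_ + X)%N]addnC.
rewrite (perm_foldr_ray_integral 0 (mK c) E1) (perm_foldr_ray_integral 0 (mK d) E2).
by rewrite !foldr_rcons ray_integral_simplex_slab.
Qed.

(** With equal labels, [T + c x + c (1 - S - x)] does not depend on [x]. The constraint factors out
    and a convolution of weights remains. *)
Lemma iter_simplex_slab n K c p :
  iter n (ray_integral 0 c) (simplex_slab K c) p =
  (gamma_weight n (1 - p.1) * (p.2 + c * (1 - p.1) <= K)%R%:R)%:E.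
Proof.
case: n => // n; rewrite iter_ray_integral; last exact: ge0_simplex_slab.
rewrite EFinM -integral_gamma_weight -ge0_integralZr//.
- apply: eq_integral => x _; rewrite -!EFinM mulrA /=.
  congr (_ * gamma_weight 0 _ * _)%:E; first by ring.
  by congr (nat_of_bool (_ <= _))%:R; ring.
- apply/measurable_EFinP; apply: measurable_funM.
    exact: measurable_gamma_weight.
  apply: (measurableT_comp (measurable_gamma_weight 0)).
  exact: measurable_funB.
- by move=> x _; rewrite lee_fin mulr_ge0 ?gamma_weight_ge0.
Qed.

End simplex_slab.

(** * Integrals over [R^N] as iterated ray integrals *)

Section lebesgue_tuple_integral.
Context {R : realType}.
Notation mu := (@lebesgue_measure R).
Notation M := (measurableTypeR R).

Lemma measurable_tuple_integrand N (c : nat -> R) (n : nat -> nat) (H : M * M -> \bar R) p :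
  ge0_measurable H ->
  measurable_fun setT (fun t : N.-tuple R =>
    (\prod_(l < N) gamma_weight (n l) (tnth t l))%:E *
      H (p.1 + \sum_(l < N) tnth t l, p.2 + \sum_(l < N) c l * tnth t l)%R)%E.
Proof.
move=> [mH _]; apply: emeasurable_funM.
  apply/measurable_EFinP; apply: measurable_prod => l _.
  apply: (measurableT_comp (measurable_gamma_weight (n l))); exact: measurable_tnth.
apply: (measurableT_comp mH); apply: measurable_fun_pair; apply: measurable_funD => //.
  by apply: measurable_sum => l; exact: measurable_tnth.
apply: measurable_sum => l.
apply: (@measurable_funM _ _ _ _ (cst (c l)) (fun t : N.-tuple R => tnth t l)) => //.
exact: measurable_tnth.
Qed.

Lemma ge0_tuple_integrand N (c : nat -> R) (n : nat -> nat)
    (H : M * M -> \bar R) p (t : N.-tuple R) :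
  ge0_measurable H ->
  (0 <= (\prod_(l < N) gamma_weight (n l) (tnth t l))%:E *
      H (p.1 + \sum_(l < N) tnth t l, p.2 + \sum_(l < N) c l * tnth t l)%R)%E.
Proof.
move=> [_ H0]; apply: mule_ge0 => //; rewrite lee_fin prodr_ge0// => l _.
exact: gamma_weight_ge0.
Qed.

(** By induction on [N]: the first coordinate gives the outermost integral and moves the base point
    [p], while the other labels shift by one. Indexing [c] and [n] by naturals makes this shift a
    composition with [succn]. *)
Lemma integral_lebesgue_tuple N (c : nat -> R) (n : nat -> nat) (H : M * M -> \bar R) p :
  ge0_measurable H ->
  (\int[lebesgue_tuple N]_t
     ((\prod_(l < N) gamma_weight (n l) (tnth t l))%:E *
      H (p.1 + \sum_(l < N) tnth t l, p.2 + \sum_(l < N) c l * tnth t l)%R) =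
  foldr (fun l => ray_integral (n l) (c l)) H (iota 0 N) p)%E.
Proof.
move=> mH; elim: N c n p => [|N IH] c n p.
  rewrite [LHS]integral_dirac//; last exact: (measurable_tuple_integrand c n p mH).
  by rewrite diracT mul1e !big_ord0 mul1e !addr0 -surjective_pairing.
rewrite [LHS](@ge0_integral_pushforward _ _ _ _ _ _ (@measurable_cons_pair R N)
  (mu \x lebesgue_tuple N)%E)//; last 2 first.
- exact: (measurable_tuple_integrand (N := N.+1) c n p mH).
- by move=> t _; exact: (ge0_tuple_integrand c n p t mH).
rewrite preimage_setT fubini_tonelli1; last 2 first.
- exact: (measurableT_comp (measurable_tuple_integrand (N := N.+1) c n p mH)
    (@measurable_cons_pair R N)).
- by move=> z; exact: (ge0_tuple_integrand c n p _ mH).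
rewrite /= (iotaDl 1) foldr_map.
apply: eq_integral => x _.
have /= <- := IH (c \o succn) (n \o succn) (p.1 + x, p.2 + c 0%N * x).
have mI := measurable_tuple_integrand (N := N) (c \o succn) (n \o succn)
  (p.1 + x, p.2 + c 0%N * x) mH.
have I0 t := ge0_tuple_integrand (N := N) (c \o succn) (n \o succn)
  (p.1 + x, p.2 + c 0%N * x) t mH.
rewrite -ge0_integralZl//; last by rewrite lee_fin gamma_weight_ge0.
apply: eq_integral => t _; rewrite /= !big_ord_recl muleA -EFinM.
have tS l : tnth (cons_pair (x, t)) (lift ord0 l) = tnth t l by exact: tnthS.
have t0 : tnth (cons_pair (x, t)) ord0 = x by [].
rewrite t0 !addrA; congr (_%:E * H (_, _))%E; [congr (_ * _)|congr (_ + _)|congr (_ + _)].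
all: apply: eq_bigr => l _; by rewrite tS.
Qed.

(** Read from right to left, this groups equal labels: a run of [n l + 1] plain operators becomes
    one integral of weight [n l]. *)
Lemma foldr_ray_integral_flatten (c : nat -> R) (n : nat -> nat) (H : M * M -> \bar R) s :
  ge0_measurable H ->
  foldr (fun l => ray_integral (n l) (c l)) H s =
  foldr (ray_integral 0) H (flatten [seq nseq (n l).+1 (c l) | l <- s]).
Proof.
move=> mH; elim: s => //= l s ->.
set s' := flatten _; rewrite foldr_cat -iter_ray_integral; last first.
  exact: ge0_foldr_ray_integral.
by rewrite -foldr_nseq.
Qed.

(** The chart eliminates coordinate 0, so the label [c 0] goes into the slab. Each remaining
    coordinate contributes one operator of weight 0. *)
Lemma hyperplane_lebesgue_slab m (c : nat -> R) (K : R) :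
  hyperplane_lebesgue ([set a : m.+1.-tuple R | \sum_(i < m.+1) c i * tnth a i <= K]
    `&` @std_simplex R m.+1) =
  foldr (ray_integral 0) (simplex_slab K (c 0%N)) [seq c l.+1 | l <- iota 0 m] (0, 0).
Proof.
have mK := ge0_simplex_slab K (c 0%N).
rewrite foldr_map -(integral_lebesgue_tuple m (c \o succn) (fun=> 0%N) (0, 0) mK) /=.
have h0 (t : m.-tuple R) : tnth (simplex_chart (m := m.+1) t) ord0 = 1 - \sum_(l < m) tnth t l.
  by rewrite tnth_mktuple.
have hS (t : m.-tuple R) l : tnth (simplex_chart (m := m.+1) t) (lift ord0 l) = tnth t l.
  by rewrite tnth_mktuple/= (tnth_nth 0).
set f := (X in integral _ _ X).
rewrite /hyperplane_lebesgue /pushforward; set V := _ @^-1` _.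
(* The factors of the integrand encode nonnegativity of the [t_l], nonnegativity of the eliminated
   coordinate, and the linear constraint. *)
have fE : f = EFin \o \1_V.
  apply/funext => t; rewrite /f /simplex_slab/= -EFinM; congr EFin.
  rewrite !add0r indicE.
  have -> : (t \in V) = [&& [forall l, 0 <= tnth t l], 0 <= 1 - \sum_(l < m) tnth t l &
      \sum_(l < m) c l.+1 * tnth t l + c 0%N * (1 - \sum_(l < m) tnth t l) <= K].
    apply/idP/and3P => [|[/forallP t0 s0 cK]].
      rewrite inE => -[]/=; rewrite !big_ord_recl h0 => cK [a0 _]; split.
      - by apply/forallP => l; move: (a0 (lift ord0 l)); congr (_ <= _); exact: hS.
      - by move: (a0 ord0); congr (_ <= _); exact: h0.
      - move: cK; congr (_ <= _); rewrite addrC; congr (_ + _).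
        by apply: eq_bigr => l _; congr (_ * _); exact: hS.
    rewrite inE; split=> /=.
      move: cK; congr (_ <= _); rewrite big_ord_recl h0 addrC; congr (_ + _).
      by apply: eq_bigr => l _; congr (_ * _); exact/esym/hS.
    split; last first.
      rewrite big_ord_recl h0 -[RHS](subrK (\sum_(l < m) tnth t l)); congr (_ + _).
      by apply: eq_bigr => l _; exact: hS.
    move=> i; case: (unliftP ord0 i) => [l|] ->.
      by move: (t0 l); congr (_ <= _); exact/esym/hS.
    by move: s0; congr (_ <= _); exact/esym/h0.
  rewrite -mulnb natrM -mulnb natrM; congr (_ * (_ * _)); last by rewrite gamma_weight0.
  under eq_bigr do rewrite gamma_weight0.
  have [/forallP h|/forallPn[l /negPf h]] := boolP [forall l, 0 <= tnth t l].
    by rewrite big1// => l _; rewrite h.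
  by rewrite (bigD1 l)//= h mul0r.
(* Measurability of [V] is inherited from the integrand, which is its indicator. *)
have mV : measurable V.
  apply/measurable_indicP/measurable_EFinP.
  have := measurable_tuple_integrand (N := m) (c \o succn) (fun=> 0%N) (0, 0) mK.
  by rewrite -[X in measurable_fun _ X]/f fE; exact.
by rewrite fE [RHS]integral_indic// setIT.
Qed.

End lebesgue_tuple_integral.

(** * Grouping the coordinates of a uniform point of the simplex by label *)

Lemma perm_flatten_nseq_count (s : seq nat) N : all (fun x => x < N)%N s ->
  perm_eq s (flatten [seq nseq (count_mem l s) l | l <- iota 0 N]).
Proof.
move=> /allP sN; apply/allP => x _; apply/eqP.
rewrite count_flatten -map_comp sumnE big_map.
(* Only the block [l = x] contributes occurrences of [x]. For [x >= N] there is no such block, and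
   both counts vanish. *)
rewrite (eq_bigr (fun l => if l == x then count_mem l s else 0%N)); last first.
  by move=> l _; rewrite /= count_nseq/=; case: eqP; rewrite ?mul1n ?mul0n.
rewrite -big_mkcond/=.
have [xN|xN] := ltnP x N.
  rewrite -big_filter (_ : seq.filter _ _ = [:: x]) ?big_seq1//.
  by rewrite filter_pred1_uniq ?iota_uniq// mem_iota.
rewrite big_seq_cond big_pred0; last first.
  by move=> l; rewrite mem_iota/=; apply/andP => -[lN /eqP lx]; move: xN; rewrite -lx leqNgt lN.
by apply/count_memPn/negP => /sN; rewrite ltnNge xN.
Qed.

Section uniform_simplex_aggregation.
Context {R : realType}.

(** With all labels and the bound equal to 0 the constraint is void, and [iter_simplex_slab] at the
    origin gives the weight [m] at 1. *)
Lemma hyperplane_lebesgue_simplex m :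
  hyperplane_lebesgue (@std_simplex R m.+1) = (m`!%:R^-1)%:E.
Proof.
have := hyperplane_lebesgue_slab m (fun=> 0 : R) 0.
rewrite (_ : _ `&` _ = @std_simplex R m.+1); last first.
  by apply/setIidPr => a _ /=; rewrite big1// => i _; rewrite mul0r.
move=> ->; rewrite (_ : map _ _ = nseq m 0); last first.
  by rewrite -[in RHS](size_iota 0 m); elim: (iota 0 m) => //= l s ->.
rewrite foldr_nseq iter_simplex_slab/= subr0 mulr1 addr0 lexx mulr1 /gamma_weight ler01 mul1r.
by rewrite expr1n mul1r.
Qed.

(** This is the aggregation property of the Dirichlet distribution: the sums over label classes are
    Dirichlet with the class sizes as parameters. As the classes are nonempty, the subtraction in
    [n l - 1] does not truncate. *)
Lemma uniform_simplex_aggregate m (f : 'I_m -> nat) N (n : nat -> nat) (K : R) :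
  (0 < m)%N -> (forall i, f i <= N)%N ->
  (forall l, n l = #|[set i | f i == l]%SET|) ->
  (forall l, (l <= N)%N -> 0 < n l)%N ->
  let t0 (t : N.-tuple R) := 1 - \sum_(l < N) tnth t l in
  let D := [set t : N.-tuple R |
    [/\ forall l, 0 <= tnth t l,
        \sum_(l < N) tnth t l <= 1 &
        \sum_(l < N) l.+1%:R * tnth t l <= K]] in
  uniform_simplex [set a : m.-tuple R | \sum_(i < m) (f i)%:R * tnth a i <= K] =
  ((((m - 1)`!)%:R / \prod_(0 <= l < N.+1) ((n l - 1)`!)%:R)%:E *
   \int[lebesgue_tuple N]_(t in D)
     (t0 t ^+ (n 0%N - 1) * \prod_(l < N) tnth t l ^+ (n l.+1 - 1))%:E)%E.
Proof.
case: m f => // m f _ fN nE n0 t0 D.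
rewrite /uniform_simplex hyperplane_lebesgue_simplex subn1/=.
pose c (i : nat) : R := (f (inord i))%:R.
rewrite (_ : [set a : m.+1.-tuple R | _] =
    [set a : m.+1.-tuple R | \sum_(i < m.+1) c i * tnth a i <= K]); last first.
  by apply/seteqP; split=> a /=; congr (_ <= _); apply: eq_bigr => i _;
    rewrite /c inord_val.
rewrite hyperplane_lebesgue_slab.
(* The eliminated coordinate is relabelled 0, which is possible because [n 0 > 0]. The other
   [n 0 - 1] zeros come last, hence innermost, where [iter_simplex_slab] evaluates them. *)
have labs : perm_eq (c 0%N :: [seq c l.+1 | l <- iota 0 m])
    (0 :: (flatten [seq nseq (n l.+1 - 1).+1 l.+1%:R | l <- iota 0 N] ++ nseq (n 0%N - 1) 0)).
  have fN' : all (fun x => x < N.+1)%N (codom f).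
    by apply/allP => x /codomP[i ->]; rewrite ltnS.
  have /(perm_map (fun l => l%:R : R)) := perm_flatten_nseq_count fN'.
  have -> : [seq l%:R | l <- codom f] = c 0%N :: [seq c l.+1 | l <- iota 0 m].
    have -> : [seq c l.+1 | l <- iota 0 m] = map c (iota 1 m).
      by rewrite (iotaDl 1 0) -map_comp.
    rewrite -[RHS]/(map c (iota 0 m.+1)) -val_enum_ord /codom /image_mem -!map_comp.
    by apply: eq_map => i; rewrite /= /c inord_val.
  rewrite map_flatten -map_comp.
  rewrite (eq_in_map _ (fun l => nseq (n l - 1).+1 l%:R) _).1; last first.
    move=> l; rewrite mem_iota/= add0n ltnS => lN.
    rewrite /= map_nseq -[RHS]/(nseq (n l - 1).+1 _) subn1 prednK ?n0// nE; congr nseq.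
    rewrite /codom /image_mem count_map enumT cardE /enum_mem size_filter.
    by apply: eq_count => i; rewrite /= inE.
  move=> /perm_trans -> //=.
  by rewrite (iotaDl 1 0 N) -map_comp/= perm_cons perm_catC.
rewrite (perm_simplex_slab K labs) foldr_cat foldr_nseq.
have mH : ge0_measurable (iter (n 0%N - 1) (ray_integral 0 0) (simplex_slab K 0)).
  by apply: ge0_iter_ray_integral; exact: ge0_simplex_slab.
have := foldr_ray_integral_flatten (fun l => l.+1%:R) (fun l => (n l.+1 - 1)%N) (iota 0 N) mH.
move=> <-; rewrite -integral_lebesgue_tuple//.
have mI := measurable_tuple_integrand (N := N) (fun l => l.+1%:R)
  (fun l => (n l.+1 - 1)%N) (0, 0) mH.
have I0 t := ge0_tuple_integrand (N := N) (fun l => l.+1%:R)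
  (fun l => (n l.+1 - 1)%N) (0, 0) t mH.
(* Extended division agrees with real division because the volume of the simplex is nonzero. *)
rewrite inver ifF; last by apply/negbTE; rewrite invr_eq0 pnatr_eq0 -lt0n fact_gt0.
rewrite invrK muleC EFinM -muleA; congr (_ * _)%E.
rewrite [in RHS]integral_mkcond; set C := \prod_(_ <= _ < _) _.
have C_neq0 : C != 0.
  by rewrite prodf_seq_neq0; apply/allP => l _ /=; rewrite pnatr_eq0 -lt0n fact_gt0.
have C_ge0 : 0 <= C by apply: prodr_ge0.
pose h := fun t : N.-tuple R => ((\prod_(l < N) gamma_weight (n l.+1 - 1) (tnth t l))%:E *
  iter (n 0%N - 1) (ray_integral 0 0) (simplex_slab K 0)
    (0 + \sum_(l < N) tnth t l, 0 + \sum_(l < N) l.+1%:R * tnth t l)%R)%E.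
rewrite [X in integral _ _ X = _](_ : _ = h)//.
(* The constant [C] cancels the factorials of the truncated powers. Outside [D], each failed
   condition makes one factor of [h] vanish. *)
rewrite [X in (_ * integral _ _ X)%E](_ : _ = (fun t => C%:E * h t)%E).
  rewrite [in RHS]ge0_integralZl//; last by move=> t _; exact: I0.
  by rewrite muleA -EFinM mulVf// mul1e.
apply/funext => t; rewrite patchE /h iter_simplex_slab/= !add0r mul0r addr0 -!EFinM.
case: ifPn => [|]; rewrite ?notin_setE ?inE /D/=.
  move=> [t_ge0 t_le1 ->]; rewrite mulr1 ge0_gamma_weightE ?subr_ge0//.
  have -> : \prod_(l < N) gamma_weight (n l.+1 - 1) (tnth t l) =
      \prod_(l < N) (tnth t l ^+ (n l.+1 - 1) / (n l.+1 - 1)`!%:R).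
    by apply: eq_bigr => l _; rewrite ge0_gamma_weightE.
  have CE : C = (n 0%N - 1)`!%:R * \prod_(l < N) (n l.+1 - 1)`!%:R.
    by rewrite /C big_mkord big_ord_recl.
  rewrite prodf_div mulf_div [X in _ / X]mulrC -CE [C * _]mulrC mulfVK//.
  by rewrite mulrC.
move=> tD; congr EFin; rewrite -[LHS](mulr0 C); congr (C * _); apply/esym.
have [/forallP t_ge0|/forallPn[l]] := boolP [forall l, 0 <= tnth t l]; last first.
  by rewrite -ltNge => tl; rewrite (bigD1 l)//= lt0_gamma_weightE// !mul0r.
have [t_le1|t_gt1] := leP (\sum_(l < N) tnth t l) 1; last first.
  by rewrite [gamma_weight _ (1 - _)]lt0_gamma_weightE ?subr_lt0// mul0r mulr0.
by case: leP => [tK|]; [exfalso; apply: tD | rewrite !mulr0].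
Qed.

End uniform_simplex_aggregation.

(** * The range of the copula values at a mesh point *)

Section permutation_count.
Variable k : nat.
Implicit Types (i j l : nat) (pi : {perm 'I_k}).

Definition corner_count pi i j : nat :=
  #|[set m : 'I_k | (m < i)%N && (pi m < j)%N]%SET|.

Lemma card_ord_ltn i : (i <= k)%N -> #|[set m : 'I_k | (m < i)%N]%SET| = i.
Proof.
move=> ik; rewrite cardsE -sum1_card -[RHS]card_ord -sum1_card.
by rewrite (big_ord_widen k (fun=> 1%N)).
Qed.

(** Inclusion-exclusion for the [i] positions below [i] and the [j] positions whose image is below
    [j]. *)
Lemma corner_count_bounds pi i j : (i <= k)%N -> (j <= k)%N ->
  (i + j - k <= corner_count pi i j <= minn i j)%N.
Proof.
move=> ik jk.
pose A := [set m : 'I_k | (m < i)%N]%SET; pose B := [set m : 'I_k | (pi m < j)%N]%SET.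
have cA : #|A| = i by exact: card_ord_ltn.
have cB : #|B| = j.
  rewrite -[RHS](card_ord_ltn jk) -[in RHS](card_preimset _ (@perm_inj _ pi)).
  by apply: eq_card => m; rewrite !inE.
have -> : corner_count pi i j = #|A :&: B|%SET.
  by apply: eq_card => m; rewrite !inE.
have := cardsUI A B; rewrite cA cB.
have := subset_leq_card (subsetIl A B); have := subset_leq_card (subsetIr A B).
have := subset_leq_card (finset.subsetT (A :|: B)%SET).
rewrite cardsT card_ord cA cB leq_min.
lia.
Qed.

(** This makes every class of permutations nonempty, as the aggregation requires. *)
Lemma exists_corner_count i j l : (i <= k)%N -> (j <= k)%N ->
  (i + j - k <= l <= minn i j)%N -> exists pi, corner_count pi i j = l.
Proof.
move=> ik jk; rewrite leq_min => /and3P[lol li lj].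
have [k0|k_gt0] := posnP k.
  exists 1%g; have := corner_count_bounds 1%g ik jk.
  by rewrite leq_min; lia.
(* Rotating by [i - l] sends exactly the block [i - l, .., i - l + j - 1]
   below [j]. *)
pose rot (m : 'I_k) : 'I_k := Ordinal (ltn_pmod (m + (k - (i - l))) k_gt0).
have rot_inj : injective rot.
  move=> m1 m2 /(congr1 val) /= /eqP; rewrite eqn_modDr !modn_small// => /eqP.
  exact: val_inj.
exists (perm rot_inj).
(* The positions counted are [i - l <= m < i]. A smaller [m] lands at [m + k - (i - l)], which is at
   least [j] since [l >= i + j - k]. *)
transitivity #|[set m : 'I_k | (m < i)%N] :\: [set m : 'I_k | (m < i - l)%N]|%SET.
  apply: eq_card => m; rewrite !inE permE /= andbC -leqNgt.
  have [mi|] := ltnP m i; last by rewrite !andbF.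
  rewrite !andbT; have [sm|ms] := leqP (i - l) m.
    have -> : (m + (k - (i - l)) = (m - (i - l)) + k)%N by lia.
    rewrite modnDr modn_small; last by have := ltn_ord m; lia.
    by lia.
  by rewrite modn_small; lia.
rewrite cardsD (finset.setIidPr _); last by apply/fintype.subsetP => m; rewrite !inE; lia.
by rewrite !card_ord_ltn; lia.
Qed.

End permutation_count.

(** * From the random copula to labelled simplex coordinates *)

Lemma perm_copulaE (R : realType) k (pi : {perm 'I_k}) (i j : 'I_k.+1) :
  perm_copula pi i j = k%:R^-1 * (corner_count pi i j)%:R :> R.
Proof. by []. Qed.

Lemma perms_with_valueE (R : realType) k (i j : 'I_k.+1) l : (0 < k)%N ->
  perms_with_value R i j l = [set pi | corner_count pi i j == l]%SET.
Proof.
move=> k0; apply/setP => pi; rewrite !inE perm_copulaE [RHS]eq_sym mulrC.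
rewrite -(inj_eq (mulIf (_ : k%:R != 0 :> R))) ?pnatr_eq0 -?lt0n//.
by rewrite !mulfVK ?pnatr_eq0 -?lt0n// eqr_nat eq_sym.
Qed.

Theorem proposition4p4 (R : realType) (k : nat) (hk : (2 <= k)%N)
    (d : measure_display) (Om : measurableType d) (P : probability Om R)
    (alpha : {perm 'I_k} -> {RV P >-> R}) (halpha : uniform_on_simplex alpha)
    (i j : 'I_k.+1) (w : R) (hw : 0 <= w <= 1) :
  let u : R := i%:R / k%:R in
  let v : R := j%:R / k%:R in
  let lo := (i + j - k)%N in (* truncated, so max {0, i + j - k} *)
  let N := (minn i j - lo)%N in
  let n (lhat : nat) := #|perms_with_value R i j (lo + lhat)| in
  (* [tnth t l], for l in {0, .., N-1}, is t_(l+1) *)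
  let t0 (t : N.-tuple R) := 1 - \sum_(l < N) tnth t l in
  let D := [set t : N.-tuple R |
    [/\ forall l, 0 <= tnth t l,
        \sum_(l < N) tnth t l <= 1 &
        \sum_(l < N) l.+1%:R * tnth t l <= k%:R * (w - frechet_lower u v)]] in
  P [set om | random_copula alpha i j om <= w] =
  ((((k`! - 1)`!)%:R / \prod_(0 <= lhat < N.+1) ((n lhat - 1)`!)%:R)%:E *
   \int[lebesgue_tuple N]_(t in D)
     (t0 t ^+ (n 0%N - 1) * \prod_(l < N) tnth t l ^+ (n l.+1 - 1))%:E)%E.
Proof.
move=> u v lo N n t0 D.
have k0 : (0 < k)%N by exact: ltnW.
have kR : k%:R != 0 :> R by rewrite pnatr_eq0 -lt0n.
have ik : (i <= k)%N by rewrite -ltnS.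
have jk : (j <= k)%N by rewrite -ltnS.
pose A := [set a : #|{perm 'I_k}|.-tuple R |
  \sum_(m < #|{perm 'I_k}|) tnth a m * perm_copula (enum_val m) i j <= w].
(* The label of a permutation is its shifted value [lhat], which lies between 0 and [N]. *)
pose f (m : 'I_#|{perm 'I_k}|) := (corner_count (enum_val m) i j - lo)%N.
have mA : measurable A.
  have mg : measurable_fun setT (fun a : #|{perm 'I_k}|.-tuple R =>
      \sum_(m < #|{perm 'I_k}|) tnth a m * perm_copula (enum_val m) i j <= w).
    apply: measurable_fun_ler => //; apply: measurable_sum => m.
    apply: (@measurable_funM _ _ _ _ (fun a : #|{perm 'I_k}|.-tuple R => tnth a m)
      (cst (perm_copula (enum_val m) i j))) => //.
    exact: measurable_tnth.
  by rewrite -[A]setTI; exact: (mg measurableT [set true]).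
have cardP : #|{perm 'I_k}| = k`! by rewrite card_Sn.
have enum_bij := onW_bij predT (@enum_val_bij {perm 'I_k}).
have -> : [set om | random_copula alpha i j om <= w] =
    [set om | A [tuple alpha (enum_val m) om | m < #|{perm 'I_k}|]].
  apply/seteqP; split=> om /=; congr (_ <= _).
    rewrite /random_copula (reindex _ enum_bij).
    by apply: eq_bigr => m _; rewrite tnth_mktuple.
  rewrite /random_copula [RHS](reindex _ enum_bij).
  by apply: eq_bigr => m _; rewrite tnth_mktuple.
rewrite halpha//.
(* The truncated subtraction in [lo] matches the maximum with 0 in [frechet_lower]. *)
have lo_frechet : k%:R * frechet_lower u v = lo%:R.
  rewrite /frechet_lower maxr_pMr ?ler0n// mulr0 /u /v.
  rewrite mulrBr mulrDr !mulr1 [_ * (i%:R / _)]mulrC [_ * (j%:R / _)]mulrC !mulfVK//.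
  rewrite /lo -natrD; have [le_ij|lt_ij] := leqP (i + j) k.
    by rewrite (eqP le_ij); apply/max_idPl; rewrite subr_le0 ler_nat.
  by rewrite natrB ?(ltnW lt_ij)//; apply/max_idPr; rewrite subr_ge0 ler_nat ltnW.
(* As the weights sum to 1, subtracting [lo] from the scaled inequality lowers every label by
   [lo]. *)
have Y_le_w (a : #|{perm 'I_k}|.-tuple R) : \sum_(m < #|{perm 'I_k}|) tnth a m = 1 ->
    (\sum_(m < #|{perm 'I_k}|) tnth a m * perm_copula (enum_val m) i j <= w) =
    (\sum_(m < #|{perm 'I_k}|) (f m)%:R * tnth a m <= k%:R * (w - frechet_lower u v)).
  move=> a1; have loE : lo%:R = \sum_(m < #|{perm 'I_k}|) lo%:R * tnth a m.
    by rewrite -mulr_sumr a1 mulr1.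
  rewrite mulrBr lo_frechet lerBrDr loE -big_split/=.
  rewrite -[in RHS](ler_pM2l (x := k%:R^-1)) ?invr_gt0 ?ltr0n// mulKf// mulr_sumr.
  congr (_ <= _); apply: eq_bigr => m _.
  have /andP[lo_le _] := corner_count_bounds (enum_val m) ik jk.
  by rewrite perm_copulaE -mulrDl -natrD subnK// mulrCA [tnth _ _ * _]mulrC.
(* The two half-spaces need only agree on the simplex, since [uniform_simplex] intersects with
   it. *)
have -> : uniform_simplex A = uniform_simplex [set a : #|{perm 'I_k}|.-tuple R |
    \sum_(m < #|{perm 'I_k}|) (f m)%:R * tnth a m <= k%:R * (w - frechet_lower u v)].
  rewrite /uniform_simplex; congr (hyperplane_lebesgue _ / _)%E.
  apply/seteqP; split=> a [/= Aa [a_ge0 a1]]; split=> //; first by rewrite /= -Y_le_w.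
  by rewrite /A/= Y_le_w.
rewrite (@uniform_simplex_aggregate _ _ f N n)//.
- by rewrite cardP.
- by rewrite cardP fact_gt0.
- move=> m; rewrite /f /N leq_sub2r//.
  by have /andP[] := corner_count_bounds (enum_val m) ik jk.
- move=> l; rewrite /n perms_with_valueE//.
  rewrite -(on_card_preimset (onW_bij _ (@enum_val_bij {perm 'I_k}))).
  apply: eq_card => m; rewrite !inE /f.
  have /andP[lo_le _] := corner_count_bounds (enum_val m) ik jk.
  by rewrite -[RHS](eqn_add2l lo) subnKC.
- move=> l lN; rewrite /n perms_with_valueE//; apply/card_gt0P.
  have [|pi pil] := @exists_corner_count k i j (lo + l) ik jk.
    by move: lN; rewrite /N /lo; lia.
  by exists pi; rewrite inE pil.
Qed.
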